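(* Let $A,B\in\mathcal{P}_n$, $K\in\mathcal{M}_n$, and $p,q,s\in\mathbb{R}$. Put $$\Psi_{p,q,s}(A,B)=\mathrm{Tr}\left(B^{\frac q2}K^*A^pKB^{\frac q2}\right)^s.$$ (i) If $s,p,q>0$, or if $s>0$ and $p,q<0$, then $$\Psi_{p,q,s}(A,B)=\min_{Z>0}\left\{\left(\mathrm{Tr}\,(Z^{-\frac12}K^*A^pKZ^{-\frac12})^{\frac{s(p+q)}{p}}\right)^{\frac{p}{p+q}}\cdot\left(\mathrm{Tr}\,(Z^{\frac12}B^qZ^{\frac12})^{\frac{s(p+q)}{q}}\right)^{\frac{q}{p+q}}\right\}$$ and $$\Psi_{p,q,s}(A,B)=\min_{Z>0}\left\{\frac{p}{p+q}\mathrm{Tr}\,(Z^{-\frac12}K^*A^pKZ^{-\frac12})^{\frac{s(p+q)}{p}}+\frac{q}{p+q}\mathrm{Tr}\,(Z^{\frac12}B^qZ^{\frac12})^{\frac{s(p+q)}{q}}\right\}.$$ (ii) If $s>0,\ p>0,\ q<0$ with $p+q>0$, or if $s>0,\ p<0,\ q>0$ with $p+q<0$, then $$\Psi_{p,q,s}(A,B)=\max_{Z>0}\left\{\left(\mathrm{Tr}\,(Z^{-\frac12}K^*A^pKZ^{-\frac12})^{\frac{s(p+q)}{p}}\right)^{\frac{p}{p+q}}\cdot\left(\mathrm{Tr}\,(Z^{\frac12}B^qZ^{\frac12})^{\frac{s(p+q)}{q}}\right)^{\frac{q}{p+q}}\right\}$$ and $$\Psi_{p,q,s}(A,B)=\m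ax_{Z>0}\left\{\frac{p}{p+q}\mathrm{Tr}\,(Z^{-\frac12}K^*A^pKZ^{-\frac12})^{\frac{s(p+q)}{p}}+\frac{q}{p+q}\mathrm{Tr}\,(Z^{\frac12}B^qZ^{\frac12})^{\frac{s(p+q)}{q}}\right\}.$$
   Context: $\mathcal{M}_n$ is the set of $n\times n$ matrices and $\mathcal{P}_n$ the set of $n\times n$ positive definite matrices; $Z>0$ means $Z\in\mathcal{P}_n$. Powers of positive (semi)definite matrices are taken by functional calculus; $\mathrm{Tr}\,X^s$ means $\mathrm{Tr}(X^s)$.
   Formalization: For singular K the min/max over Z>0 need not be attained (K=0, n=p=q=s=A=B=1: the sum is z²/2>0=Ψ); proved instead: infimum/supremum for every K, attained min/max when K is invertible, and for the product also when K=0. *)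

(* Defs.v *)
From mathcomp Require Import all_boot all_order all_algebra.
From mathcomp Require Import sesquilinear spectral.
From mathcomp Require Import all_classical all_reals exp.
From mathcomp.real_closed Require Import complex.

Set Implicit Arguments.
Unset Strict Implicit.
Unset Printing Implicit Defensive.

Import Order.TTheory GRing.Theory Num.Theory.

Local Open Scope classical_set_scope.
Local Open Scope ring_scope.
Local Open Scope complex_scope.
Local Open Scope sesquilinear_scope.

Definition posdefmx {R : realType} (n : nat) : set 'M[R[i]]_n :=
  [set A | A \is hermsymmx /\
           forall v : 'cV[R[i]]_n, v != 0 -> 0 < (v ^t* *m A *m v) 0 0].

(* Functional calculus for t |-> t `^ r, meant for A positive semidefinite with
   r > 0, or A positive definite.  The eigenvalues are then real, so Re only
   changes their type, and 0 `^ r = 0 for r > 0. *)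
Definition powmx {R : realType} (n : nat) (A : 'M[R[i]]_n) (r : R) :
    'M[R[i]]_n :=
  invmx (spectralmx A)
  *m diag_mx (\row_(i < n) (complex.Re (spectral_diag A 0 i) `^ r)%:C)
  *m spectralmx A.

(* The trace is real for the matrices described above. *)
Definition trpow {R : realType} (n : nat) (A : 'M[R[i]]_n) (r : R) : R :=
  complex.Re (\tr (powmx A r)).

Definition Psi {R : realType} (n : nat) (K : 'M[R[i]]_n) (p q s : R)
    (A B : 'M[R[i]]_n) : R :=
  trpow (powmx B (q / 2) *m K ^t* *m powmx A p *m K *m powmx B (q / 2)) s.

Definition trA {R : realType} (n : nat) (K : 'M[R[i]]_n) (p q s : R)
    (A Z : 'M[R[i]]_n) : R :=
  trpow (powmx Z (- 2^-1) *m K ^t* *m powmx A p *m K *m powmx Z (- 2^-1))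
        (s * (p + q) / p).

Definition trB {R : realType} (n : nat) (p q s : R) (B Z : 'M[R[i]]_n) : R :=
  trpow (powmx Z 2^-1 *m powmx B q *m powmx Z 2^-1) (s * (p + q) / q).

Definition prod_values {R : realType} (n : nat) (K : 'M[R[i]]_n) (p q s : R)
    (A B : 'M[R[i]]_n) : set R :=
  [set (trA K p q s A Z) `^ (p / (p + q)) * (trB p q s B Z) `^ (q / (p + q))
    | Z in @posdefmx R n].

Definition sum_values {R : realType} (n : nat) (K : 'M[R[i]]_n) (p q s : R)
    (A B : 'M[R[i]]_n) : set R :=
  [set p / (p + q) * trA K p q s A Z + q / (p + q) * trB p q s B Z
    | Z in @posdefmx R n].

(* For singular K the extremum over the open set Z > 0 need not be attained:
   for K = 0 and n > 0, the elements of sum_values are nonzero, of constant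
   sign, and come arbitrarily close to 0 = Psi.  In general it is therefore only
   an infimum (supremum); it is a minimum (maximum) for invertible K and, in
   the case of prod_values, also for K = 0. *)
Definition is_min {R : realType} (E : set R) (m : R) : Prop :=
  E m /\ lbound E m.

Definition is_max {R : realType} (E : set R) (m : R) : Prop :=
  E m /\ ubound E m.

(* Main.v *)
Require Import Defs.
From mathcomp Require Import all_boot all_order all_algebra.
From mathcomp Require Import sesquilinear spectral.
From mathcomp Require Import all_classical all_reals exp.
From mathcomp.real_closed Require Import complex.
From mathcomp Require Import perm ring lra.

(* Write [C] for [K^* A^p K], [E] for [B^(q/2)] and [a = p/(p+q)],
   [b = q/(p+q)], so that [a + b = 1].  Since [E C E] has the characteristic
   polynomial of [(Z^-1/2 C Z^-1/2) (Z^1/2 E^2 Z^1/2)], the bounds are Hoelder's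
   inequality for Schatten quasi-norms ([a, b > 0]) and its reversed form
   ([b < 0]), followed by Young's inequality for the sum.

   Hoelder's inequality follows from scalar Hoelder on the diagonals of
   triangular factors, once Weyl's inequality
   [\sum_i |L i i|^(2r) <= \tr H^r] is known for [W H^1/2 = L V], [L]
   triangular and [V], [W] unitary.  For the latter, [H^1/2] is written as a product of [m]
   copies of [S = H^(1/2m)], each of which is QR-factored along a chain of
   orthonormal bases; then [|L i i|^2] is at most a product of [m] diagonal
   entries of matrices [V S^2 V^*], and for [m r >= 1] AM-GM and Jensen apply.

   In an eigenbasis [W] of [E C E] with eigenvalues [t], equality holds at
   [Z = E^-1 W^* diag(t^b) W E^-1]; zero eigenvalues are replaced by small
   positive numbers, which leaves the first trace unchanged. *)

Set Implicit Arguments.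
Unset Strict Implicit.
Unset Printing Implicit Defensive.

Import Order.TTheory GRing.Theory Num.Theory.

Local Open Scope classical_set_scope.
Local Open Scope ring_scope.
Local Open Scope complex_scope.
Local Open Scope sesquilinear_scope.

(** * Scalar inequalities for real powers *)

Section ScalarInequalities.
Variable R : realType.
Implicit Types (a b r x y : R).

Lemma powRVK x r : 0 <= x -> r != 0 -> (x `^ r^-1) `^ r = x.
Proof. by move=> x0 r0; rewrite -powRrM mulVf// powRr1. Qed.

Lemma powRKV x r : 0 <= x -> r != 0 -> (x `^ r) `^ r^-1 = x.
Proof. by move=> x0 r0; rewrite -powRrM mulfV// powRr1. Qed.

Lemma powR_prod (I : Type) (s : seq I) (P : pred I) (f : I -> R) r :
  (forall i, 0 <= f i) ->
  (\prod_(i <- s | P i) f i) `^ r = \prod_(i <- s | P i) (f i) `^ r.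
Proof.
move=> f0; elim: s => [|i s IHs]; first by rewrite !big_nil powR1.
by rewrite !big_cons; case: ifP => // _; rewrite powRM// ?prodr_ge0// IHs.
Qed.

Lemma young_powR x y a b : 0 <= x -> 0 <= y -> 0 < a -> 0 < b -> a + b = 1 ->
  x `^ a * y `^ b <= a * x + b * y.
Proof.
move=> x0 y0 a0 b0 ab.
have := @conjugate_powR R (x `^ a) (y `^ b) a^-1 b^-1.
rewrite !powR_ge0 !invr_gt0 a0 b0 !invrK => /(_ isT isT isT isT ab).
by rewrite !powRKV ?gt_eqF// [x * a]mulrC [y * b]mulrC.
Qed.

(* Young's inequality for [x = (x `^ a * y `^ b) `^ a^-1 * y `^ (- b / a)]. *)
Lemma reverse_young_powR x y a b : 0 <= x -> 0 < y -> 0 < a -> b < 0 ->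
  a + b = 1 -> a * x + b * y <= x `^ a * y `^ b.
Proof.
move=> x0 y0 a0 b0 ab.
have := @young_powR (x `^ a * y `^ b) y a^-1 (- b / a).
rewrite mulr_ge0 ?powR_ge0// (ltW y0) invr_gt0 a0 divr_gt0 ?oppr_gt0//.
have -> : a^-1 + - b / a = 1.
  by have -> : b = 1 - a by [lra]; field; rewrite gt_eqF.
move=> /(_ isT isT isT isT erefl).
rewrite powRM ?powR_ge0// powRKV ?gt_eqF// -powRrM -mulrA -powRD; last first.
  by rewrite (gt_eqF y0) implybT.
rewrite mulNr subrr powRr0 mulr1 -(ler_pM2l a0) => le_x.
rewrite -lerBrDr (le_trans le_x)// le_eqVlt; apply/predU1P; left.
by field; rewrite gt_eqF.
Qed.

(** After division by the two sums, Young's inequality bounds each term; when a sum vanishes, so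
    does every term. *)
Lemma hoelder_sum (I : finType) (u v : I -> R) a b :
  (forall i, 0 <= u i) -> (forall i, 0 <= v i) ->
  0 < a -> 0 < b -> a + b = 1 ->
  \sum_i u i `^ a * v i `^ b <= (\sum_i u i) `^ a * (\sum_i v i) `^ b.
Proof.
move=> u0 v0 a0 b0 ab.
set U := \sum_i u i; set V := \sum_i v i.
have U0 : 0 <= U by apply: sumr_ge0.
have V0 : 0 <= V by apply: sumr_ge0.
have [UE|UN0] := eqVneq U 0.
  rewrite big1 ?mulr_ge0 ?powR_ge0// => i _.
  have /eqP := UE; rewrite psumr_eq0// => /allP/(_ i (mem_index_enum i))/eqP ->.
  by rewrite powR0 ?mul0r ?gt_eqF.
have [VE|VN0] := eqVneq V 0.
  rewrite big1 ?mulr_ge0 ?powR_ge0// => i _.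
  have /eqP := VE; rewrite psumr_eq0// => /allP/(_ i (mem_index_enum i))/eqP ->.
  by rewrite [0 `^ b]powR0 ?mulr0 ?gt_eqF.
(* The weights [a * (u i / U) + b * (v i / V)] sum to [a + b = 1]. *)
have -> : U `^ a * V `^ b =
    \sum_i U `^ a * V `^ b * (a * (u i / U) + b * (v i / V)).
  rewrite -mulr_sumr big_split/= -!mulr_sumr -!mulr_suml -/U -/V.
  by rewrite !divff// !mulr1 ab mulr1.
apply: ler_sum => i _.
rewrite -{1}(divfK UN0 (u i)) -{1}(divfK VN0 (v i)).
rewrite (powRM a (divr_ge0 (u0 i) U0) U0) (powRM b (divr_ge0 (v0 i) V0) V0).
rewrite mulrACA mulrC ler_wpM2l ?mulr_ge0 ?powR_ge0//.
by rewrite young_powR ?divr_ge0.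
Qed.

(** Hoelder's inequality for [w i * x i ^ r] and [w i] with exponents [1/r] and [1 - 1/r]; the total
    weight [1] removes the second factor. At [r = 1] the second exponent would vanish, so that case
    is separate. *)
Lemma jensen_powR (I : finType) (w x : I -> R) r :
  (forall i, 0 <= w i) -> \sum_i w i = 1 -> (forall i, 0 <= x i) -> 1 <= r ->
  (\sum_i w i * x i) `^ r <= \sum_i w i * x i `^ r.
Proof.
move=> w0 w1 x0; rewrite le_eqVlt => /predU1P[<-|r1].
  rewrite powRr1 ?sumr_ge0// => [|i _]; last by rewrite mulr_ge0.
  by apply: ler_sum => i _; rewrite powRr1.
have r0 : 0 < r by rewrite (lt_trans ltr01).
have wx0 i : 0 <= w i * x i `^ r by rewrite mulr_ge0 ?powR_ge0.
have := @hoelder_sum I (fun i => w i * x i `^ r) w r^-1 (1 - r^-1) wx0 w0.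
rewrite invr_gt0 r0 subr_gt0 invf_lt1// r1 => /(_ isT isT (subrKC _ _)).
rewrite w1 powR1 mulr1.
under eq_bigr => i _.
  rewrite powRM ?powR_ge0// powRKV ?gt_eqF// mulrAC -powRD ?subrKC
    ?oner_eq0// powRr1//.
  over.
move=> le_sum; rewrite -[leRHS](@powRVK _ r) ?gt_eqF ?sumr_ge0//.
apply: ge0_ler_powR; rewrite ?(ltW r0) ?nnegrE ?powR_ge0//.
by apply: sumr_ge0 => i _; rewrite mulr_ge0.
Qed.

(** AM-GM for the numbers [x k ^ (m r)], whose geometric mean is the [r]-th power of the product. *)
Lemma agm_powR (m : nat) (x : nat -> R) r : (0 < m)%N ->
  (forall k, 0 <= x k) ->
  (\prod_(k < m) x k) `^ r <= (\sum_(k < m) x k `^ (m%:R * r)) / m%:R.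
Proof.
move=> m0 x0; have mN0 : m%:R != 0 :> R by rewrite pnatr_eq0 -lt0n.
have := @leif_AGM R 'I_m [pred _ | true] (fun k => x k `^ (m%:R * r)).
rewrite /= card_ord => /(_ _)[|+ _].
  by move=> k _; rewrite powR_ge0.
rewrite -powR_prod//; set S := (_ / _) => le_prod.
have S0 : 0 <= S by rewrite divr_ge0 ?sumr_ge0// => k _; rewrite powR_ge0.
have -> : S = (S ^+ m) `^ m%:R^-1 by rewrite -powR_mulrn// powRKV.
have -> : (\prod_(k < m) x k) `^ r =
    ((\prod_(k < m) x k) `^ (m%:R * r)) `^ m%:R^-1.
  by rewrite -powRrM mulrAC mulfV// mul1r.
by apply: ge0_ler_powR; rewrite ?nnegrE ?invr_ge0 ?powR_ge0 ?exprn_ge0.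
Qed.

(** Converts Hoelder's inequality with exponents [1/a] and [- b / a] into its reversed form. *)
Lemma powR_solve_le x y z a b : 0 <= x -> 0 <= y -> 0 <= z -> 0 < a -> b < 0 ->
  x <= z `^ a^-1 * y `^ (- b / a) -> x `^ a * y `^ b <= z.
Proof.
move=> x0 y0 z0 a0 b0 xle.
(* A negative power of [0] is [0] by convention, so the left side vanishes. *)
have [->|yN0] := eqVneq y 0; first by rewrite powR0 ?lt_eqF// mulr0.
have xale : x `^ a <= z * y `^ (- b).
  rewrite -(@powRVK z a) ?gt_eqF// -(@divfK _ a _ (- b)) ?gt_eqF// powRrM.
  rewrite -powRM ?powR_ge0//.
  by rewrite ge0_ler_powR ?nnegrE ?mulr_ge0 ?powR_ge0 ?(ltW a0).
rewrite -ler_pdivlMr -?powRN//.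
by rewrite powR_gt0// lt_def yN0 y0.
Qed.

(** For [w = x ^ s] the divisor [w ^ (b / s)] is [x ^ b], and [x / x ^ b = x ^ a]. This balances the
    first trace at the extremal [Z]. *)
Lemma powR_balance x s a b : 0 < x -> s != 0 -> a != 0 -> a + b = 1 ->
  (x / (x `^ s) `^ (b / s)) `^ (s / a) = x `^ s.
Proof.
move=> x0 s0 a0 ab; have xN0 : x != 0 by rewrite gt_eqF.
rewrite -powRrM [s * _]mulrC divfK// -powRN -{1}(powRr1 (ltW x0)).
rewrite -powRD ?xN0 ?implybT// (_ : 1 - b = a); last by rewrite -ab addrK.
by rewrite -powRrM mulrC divfK.
Qed.

(** Absorbs an approximation error [c * d] with [c] of either sign; the divisor [|c| + 1] stays
    positive. *)
Lemma ler_addM_gt0 x y c : (forall d, 0 < d -> x <= y + c * d) -> x <= y.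
Proof.
move=> xle; apply/ler_addgt0Pr => e e0; pose d := e / (`|c| + 1).
have c1 : 0 < `|c| + 1 by rewrite ltr_wpDl.
have d0 : 0 < d by exact: divr_gt0.
rewrite (le_trans (xle d d0))// lerD2l /d mulrCA ger_pMr// ler_pdivrMr// mul1r.
by rewrite ler_wpDr// ler_norm.
Qed.

(** A common change of sign of [p] and [q] cancels in the weights, so both sign patterns become one
    case. *)
Lemma weights_same_sign (p q : R) : 0 < p /\ 0 < q \/ p < 0 /\ q < 0 ->
  [/\ 0 < p / (p + q), 0 < q / (p + q) & p / (p + q) + q / (p + q) = 1].
Proof.
move=> pq; have pq0 : p + q != 0.
  case: pq => -[p0 q0]; first by rewrite gt_eqF// addr_gt0.
  by rewrite lt_eqF// -[ltRHS]addr0 ltrD.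
split; last by rewrite -mulrDl mulfV.
all: case: pq => -[p0 q0]; first by rewrite divr_gt0// addr_gt0.
all: have pq : p + q < 0 by lra.
all: by rewrite nmulr_rgt0// invr_lt0.
Qed.

Lemma weights_opposite_sign (p q : R) :
  0 < p /\ q < 0 /\ 0 < p + q \/ p < 0 /\ 0 < q /\ p + q < 0 ->
  [/\ 0 < p / (p + q), q / (p + q) < 0 & p / (p + q) + q / (p + q) = 1].
Proof.
case=> -[p0 [q0 pq]]; split.
- by rewrite divr_gt0.
- by rewrite pmulr_llt0// invr_gt0.
- by rewrite -mulrDl mulfV// gt_eqF.
- by rewrite nmulr_rgt0// invr_lt0.
- by rewrite pmulr_rlt0// invr_lt0.
- by rewrite -mulrDl mulfV// lt_eqF.
Qed.

End ScalarInequalities.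

(** * Similarity and characteristic polynomials *)

Lemma char_poly_conj (F : fieldType) (n : nat) (P A B : 'M[F]_n) :
  P \in unitmx -> P *m A = B *m P -> char_poly A = char_poly B.
Proof.
move=> Punit PA; pose Q := map_mx polyC P.
have detQ : \det Q != 0 by rewrite det_map_mx polyC_eq0 -unitfE -unitmxE.
(* [Q] intertwines the two characteristic matrices; taking determinants, [\det Q] cancels. *)
apply: (mulfI detQ); rewrite [RHS]mulrC -!det_mulmx; congr (\det _).
rewrite /char_poly_mx mulmxBr mulmxBl scalar_mxC; congr (_ - _).
by rewrite -!map_mxM PA.
Qed.

Lemma char_poly_mulC (F : fieldType) (n : nat) (A B : 'M[F]_n) :
  A \in unitmx -> char_poly (A *m B) = char_poly (B *m A).
Proof. by move=> Aunit; apply/esym/(char_poly_conj Aunit); rewrite mulmxA. Qed.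

(** * Unitary diagonalization and triangular factorization *)

Section UnitaryDiagonal.
Variables (C : numClosedFieldType) (n : nat).
Implicit Types (U : 'M[C]_n) (d e : 'rV[C]_n).

Lemma adj_mul (m p q : nat) (X : 'M[C]_(m, p)) (Y : 'M[C]_(p, q)) :
  (X *m Y)^t* = Y^t* *m X^t*.
Proof. by rewrite trmx_mul map_mxM. Qed.

Lemma unitarymx_mulKV (m : nat) U (X : 'M[C]_(n, m)) :
  U \is unitarymx -> U *m (U^t* *m X) = X.
Proof. by move=> Uu; rewrite mulmxA (unitarymxP Uu) mul1mx. Qed.

(** For unitary [U] the eigenvectors are the columns of [U^t*], as for [spectralmx]. *)
Definition udiag U d : 'M[C]_n := U^t* *m (diag_mx d *m U).

Lemma udiagM U d e : U \is unitarymx ->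
  udiag U d *m udiag U e = udiag U (\row_i (d 0 i * e 0 i)).
Proof.
move=> Uu; rewrite /udiag -!mulmxA (unitarymx_mulKV _ Uu).
by rewrite [diag_mx d *m _]mulmxA mulmx_diag.
Qed.

Lemma udiag1 U : U \is unitarymx -> udiag U (const_mx 1) = 1%:M.
Proof.
move=> Uu; rewrite /udiag diag_const_mx mul1mx -invmx_unitary//.
by rewrite mulVmx// unitarymx_unit.
Qed.

Lemma udiag_adj U d : (udiag U d)^t* = udiag U (map_mx Num.conj d).
Proof. by rewrite /udiag !adj_mul trmxCK tr_diag_mx map_diag_mx mulmxA. Qed.

Lemma udiag_conj U V d : V *m udiag U d *m V^t* = udiag (U *m V^t*) d.
Proof. by rewrite /udiag adj_mul trmxCK !mulmxA. Qed.

Lemma unitarymx_gram (A L V : 'M[C]_n) : V \is unitarymx -> A = L *m V ->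
  L *m L^t* = A *m A^t*.
Proof.
by move=> Vu ->; rewrite adj_mul mulmxA -(mulmxA L) (unitarymxP Vu) mulmx1.
Qed.

Lemma char_poly_udiag U d : U \is unitarymx ->
  char_poly (udiag U d) = \prod_i ('X - (d 0 i)%:P).
Proof.
move=> Uu; rewrite (@char_poly_conj _ _ U _ (diag_mx d)).
- rewrite char_poly_trig ?diag_mx_is_trig//.
  by apply: eq_bigr => i _; rewrite !mxE eqxx.
- exact: unitarymx_unit.
- by rewrite /udiag (unitarymx_mulKV _ Uu).
Qed.

Lemma mxtrace_udiag U d : U \is unitarymx -> \tr (udiag U d) = \sum_i d 0 i.
Proof.
move=> Uu; rewrite /udiag mxtrace_mulC -mulmxA (unitarymxP Uu) mulmx1.
exact: mxtrace_diag.
Qed.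

Lemma form_udiag U d (v : 'cV[C]_n) :
  (v^t* *m udiag U d *m v) 0 0 = \sum_i `|(U *m v) i 0| ^+ 2 * d 0 i.
Proof.
rewrite /udiag !mulmxA -adj_mul -mulmxA.
set w := U *m v; rewrite mul_mx_diag mxE.
by apply: eq_bigr => i _; rewrite !mxE normCK mulrC mulrA.
Qed.

Lemma udiag_diagE U d i :
  udiag U d i i = \sum_j `|U j i| ^+ 2 * d 0 j.
Proof.
rewrite /udiag mul_diag_mx mxE.
by apply: eq_bigr => j _; rewrite !mxE normCK mulrCA mulrC (mulrC (U j i)).
Qed.

Lemma unitmx_udiag U d i : U \is unitarymx -> udiag U d \in unitmx ->
  d 0 i != 0.
Proof.
move=> Uu; rewrite !unitmx_mul => /and3P[_ + _].
rewrite unitmxE det_diag unitfE prodf_seq_neq0.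
by move=> /allP/(_ i (mem_index_enum i)).
Qed.

Lemma unitarymx_sum_row U i : U \is unitarymx -> \sum_j `|U i j| ^+ 2 = 1.
Proof.
move=> /unitarymxP/matrixP/(_ i i); rewrite !mxE eqxx => UE.
by rewrite -[RHS]UE; apply: eq_bigr => j _; rewrite normCK !mxE.
Qed.

Lemma unitarymx_sum_col U j : U \is unitarymx -> \sum_i `|U i j| ^+ 2 = 1.
Proof.
rewrite -trmx_unitary => Uu; rewrite -(unitarymx_sum_row j Uu).
by apply: eq_bigr => i _; rewrite mxE.
Qed.

Lemma herm_adj (A : 'M[C]_n) : A \is hermsymmx -> A^t* = A.
Proof. by move=> /is_hermitianmxP {2}->; rewrite expr0 scale1r. Qed.

Lemma adj_herm (A : 'M[C]_n) : A^t* = A -> A \is hermsymmx.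
Proof. by move=> AE; apply/is_hermitianmxP; rewrite expr0 scale1r. Qed.

Lemma spectral_udiag (A : 'M[C]_n) : A \is normalmx ->
  A = udiag (spectralmx A) (spectral_diag A).
Proof.
move=> /orthomx_spectralP{1}->.
by rewrite invmx_unitary ?spectral_unitarymx// -mulmxA.
Qed.

(** Gram-Schmidt on the rows: row [i] of [A] lies in the span of rows [0] to [i] of [schmidt A],
    hence is orthogonal to all later ones. *)
Lemma schmidt_trig (A : 'M[C]_n) : exists L V : 'M[C]_n,
  [/\ is_trig_mx L, V \is unitarymx & A = L *m V].
Proof.
have Vu := schmidt_unitarymx A (leqnn n).
exists (A *m (schmidt A)^t*), (schmidt A); split=> //; last first.
  by rewrite mulmxKtV.
apply/is_trig_mxP => i j ij.
have : (row i A <= kermx ((row j (schmidt A))^t*))%MS.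
  apply: submx_trans (row_schmidt_sub A i) _.
  apply/sumsmx_subP => k ki; rewrite genmxE; apply/sub_kermxP/matrixP => ? ?.
  rewrite !ord1 -dotmxE (row_unitarymxP Vu) [RHS]mxE.
  by rewrite -val_eqE ltn_eqF// (leq_ltn_trans ki ij).
move=> /sub_kermxP/matrixP/(_ 0 0); rewrite [RHS]mxE => <-.
by rewrite !mxE; apply: eq_bigr => k _; rewrite !mxE.
Qed.

End UnitaryDiagonal.

(** * Real functional calculus and positive semidefinite matrices *)

Section SpectralCalculus.
Variable R : realType.

(** The squared modulus, taken in [R] so that real powers apply to it. *)
Definition sqn (z : R[i]) : R := complex.Re (`|z| ^+ 2).

Lemma sqnE z : (sqn z)%:C = `|z| ^+ 2.
Proof. by rewrite RRe_real// rpredX// normr_real. Qed.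

Lemma sqn_ge0 z : 0 <= sqn z.
Proof. by rewrite -lecR sqnE exprn_ge0. Qed.

Lemma sqnM y z : sqn (y * z) = sqn y * sqn z.
Proof. by apply: complexI; rewrite rmorphM/= !sqnE normrM exprMn. Qed.

Lemma sqn1 : sqn 1 = 1.
Proof. by apply: complexI; rewrite sqnE normr1 expr1n. Qed.

Lemma sqn_eq0 z : (sqn z == 0) = (z == 0).
Proof.
by rewrite -(inj_eq (@complexI _)) sqnE expf_eq0/= normr_eq0.
Qed.

Lemma conjC_RC (x : R) : Num.conj x%:C = x%:C :> R[i].
Proof. by apply/CrealP/complex_realP; exists x. Qed.

Section Size.
Variable n : nat.
Implicit Types (A B U V W : 'M[R[i]]_n) (f g h : 'I_n -> R).

Definition RCrow h : 'rV[R[i]]_n := \row_i (h i)%:C.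

Definition specmx U h : 'M[R[i]]_n := udiag U (RCrow h).

Lemma unitarymx_sqn_row U i : U \is unitarymx -> \sum_j sqn (U i j) = 1.
Proof.
move=> Uu; apply: complexI; rewrite [RHS]rmorph1.
rewrite -(unitarymx_sum_row i Uu) rmorph_sum.
by apply: eq_bigr => j _; exact: sqnE.
Qed.

Lemma unitarymx_sqn_col U j : U \is unitarymx -> \sum_i sqn (U i j) = 1.
Proof.
move=> Uu; apply: complexI; rewrite [RHS]rmorph1.
rewrite -(unitarymx_sum_col j Uu) rmorph_sum.
by apply: eq_bigr => i _; exact: sqnE.
Qed.

Lemma specmxM U f g : U \is unitarymx ->
  specmx U f *m specmx U g = specmx U (fun i => f i * g i).
Proof.
move=> Uu; rewrite [LHS](udiagM _ _ Uu); congr udiag.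
by apply/rowP => i; rewrite !mxE rmorphM.
Qed.

Lemma specmx1 U : U \is unitarymx -> specmx U (fun=> 1) = 1%:M.
Proof.
by move=> Uu; rewrite -(udiag1 Uu); congr udiag; apply/rowP => i; rewrite !mxE.
Qed.

Lemma specmx_adj U h : (specmx U h)^t* = specmx U h.
Proof.
rewrite udiag_adj; congr udiag; apply/rowP => i; rewrite !mxE.
exact: conjC_RC.
Qed.

Lemma specmx_unit U h : U \is unitarymx -> (forall i, h i != 0) ->
  specmx U h \in unitmx.
Proof.
move=> Uu h0; have hV : specmx U h *m specmx U (fun i => (h i)^-1) = 1%:M.
  rewrite (specmxM _ _ Uu) -(specmx1 Uu); congr specmx.
  by apply/funext => i; rewrite mulfV.
exact: (proj1 (mulmx1_unit hV)).
Qed.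

Lemma specmxV U h : U \is unitarymx -> (forall i, h i != 0) ->
  invmx (specmx U h) = specmx U (fun i => (h i)^-1).
Proof.
move=> Uu h0; rewrite -[RHS](mulKmx (specmx_unit Uu h0)) (specmxM _ _ Uu).
have -> : (fun i => h i * (h i)^-1) = fun=> 1.
  by apply/funext => i; rewrite mulfV.
by rewrite (specmx1 Uu) mulmx1.
Qed.

Lemma unitmx_specmx U h i : U \is unitarymx -> specmx U h \in unitmx ->
  h i != 0.
Proof.
move=> Uu /(unitmx_udiag i Uu); rewrite mxE.
by apply: contra => /eqP ->.
Qed.

Lemma char_poly_specmx U h : U \is unitarymx ->
  char_poly (specmx U h) = \prod_i ('X - (h i)%:C%:P).
Proof.
by move=> /char_poly_udiag->; apply: eq_bigr => i _; rewrite mxE.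
Qed.

Definition eigr A (i : 'I_n) : R := complex.Re (spectral_diag A 0 i).

Lemma powmxE A r : powmx A r = specmx (spectralmx A) (fun i => eigr A i `^ r).
Proof.
by rewrite /powmx invmx_unitary ?spectral_unitarymx// -mulmxA.
Qed.

Lemma herm_specmx A : A \is hermsymmx ->
  A = specmx (spectralmx A) (eigr A).
Proof.
move=> Ah; rewrite {1}(spectral_udiag (hermitian_normalmx Ah)).
congr udiag; apply/rowP => i; rewrite mxE RRe_real//.
exact/mxOverP/hermitian_spectral_diag_real.
Qed.

Lemma trpow_eigr A r : trpow A r = \sum_i eigr A i `^ r.
Proof.
rewrite /trpow powmxE mxtrace_udiag ?spectral_unitarymx//.
rewrite [X in complex.Re X](_ : _ = (\sum_i eigr A i `^ r)%:C)// rmorph_sum.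
by apply: eq_bigr => i _; rewrite mxE.
Qed.

(** Unique factorization makes [h] a rearrangement of the eigenvalues. Traces of powers can thus be
    compared through characteristic polynomials, without exhibiting unitary equivalences. *)
Lemma trpow_char_poly A h r : A \is hermsymmx ->
  char_poly A = \prod_i ('X - (h i)%:C%:P) -> trpow A r = \sum_i h i `^ r.
Proof.
move=> Ah; rewrite {1}(herm_specmx Ah) char_poly_specmx ?spectral_unitarymx//.
rewrite trpow_eigr.
rewrite -(big_map (fun i => (eigr A i)%:C) xpredT (fun x => 'X - x%:P)).
rewrite -(big_map (fun i => (h i)%:C) xpredT (fun x => 'X - x%:P)).
move=> /prod_XsubC_eq/(perm_map (@complex.Re R)); rewrite -!map_comp => hp.
rewrite -(big_map (eigr A) xpredT (fun x => x `^ r)) (perm_big _ hp).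
by rewrite big_map.
Qed.

Lemma trpow_specmx U h r : U \is unitarymx ->
  trpow (specmx U h) r = \sum_i h i `^ r.
Proof.
move=> Uu; apply: trpow_char_poly; last exact: char_poly_specmx.
exact/adj_herm/specmx_adj.
Qed.

Lemma eq_trpow A B r : A \is hermsymmx -> B \is hermsymmx ->
  char_poly A = char_poly B -> trpow A r = trpow B r.
Proof.
move=> Ah Bh AB; have BE : char_poly B = \prod_i ('X - (eigr B i)%:C%:P).
  rewrite {1}(herm_specmx Bh); apply: char_poly_specmx.
  exact: spectral_unitarymx.
by rewrite (trpow_char_poly r Ah (etrans AB BE)) (trpow_char_poly r Bh BE).
Qed.

Definition psdmx A :=
  A \is hermsymmx /\ forall v : 'cV[R[i]]_n, 0 <= (v^t* *m A *m v) 0 0.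

Lemma posdef_psd A : posdefmx A -> psdmx A.
Proof.
move=> [Ah Apos]; split=> // v; have [->|v0] := eqVneq v 0.
  by rewrite mulmx0 mxE.
exact/ltW/Apos.
Qed.

Lemma form_specmx U h (v : 'cV[R[i]]_n) :
  (v^t* *m specmx U h *m v) 0 0 = (\sum_i sqn ((U *m v) i 0) * h i)%:C.
Proof.
rewrite form_udiag rmorph_sum; apply: eq_bigr => i _.
by rewrite [RCrow h 0 i]mxE -sqnE [RHS]rmorphM.
Qed.

(** Column [i] of [U^t*] is a unit eigenvector for [h i]; it transfers signs from the quadratic form
    to the eigenvalues. *)
Lemma form_specmx_col U h i : U \is unitarymx ->
  ((col i (U^t*))^t* *m specmx U h *m col i (U^t*)) 0 0 = (h i)%:C.
Proof.
move=> Uu; rewrite form_specmx colE mulmxA (unitarymxP Uu) mul1mx.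
rewrite (bigD1 i)//= big1 ?addr0 => [|j ji];
  rewrite mxE ?(negbTE ji)/=; last first.
  have /eqP -> : sqn (0 : R[i]) == 0 by rewrite sqn_eq0.
  by rewrite mul0r.
by rewrite !eqxx/= sqn1 mul1r.
Qed.

Lemma eigr_ge0 A : psdmx A -> forall i, 0 <= eigr A i.
Proof.
move=> [Ah Apos] i.
by rewrite -lecR -(form_specmx_col _ _ (spectral_unitarymx A)) -herm_specmx.
Qed.

Lemma eigr_gt0 A : posdefmx A -> forall i, 0 < eigr A i.
Proof.
move=> [Ah Apos] i.
rewrite -ltcR -(form_specmx_col _ _ (spectral_unitarymx A)) -herm_specmx//.
apply: Apos; apply/negP => /eqP/(congr1 (mulmx (spectralmx A))).
rewrite colE mulmxA (unitarymxP (spectral_unitarymx A)) mul1mx mulmx0.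
by move=> /matrixP/(_ i 0)/eqP; rewrite !mxE !eqxx oner_eq0.
Qed.

Lemma specmx_posdef U h : U \is unitarymx -> (forall i, 0 < h i) ->
  posdefmx (specmx U h).
Proof.
move=> Uu h0; split=> [|v v0]; first exact/adj_herm/specmx_adj.
have sh0 i : 0 <= sqn ((U *m v) i 0) * h i by rewrite mulr_ge0 ?sqn_ge0 ?ltW.
rewrite form_specmx ltcR lt_def sumr_ge0// andbT; apply: contra v0.
rewrite psumr_eq0// => /allP all0; rewrite -[v]mul1mx.
rewrite -(mulVmx (unitarymx_unit Uu)) -mulmxA (_ : U *m v = 0) ?mulmx0//.
apply/matrixP => i j; rewrite [RHS]mxE ord1.
have /= := all0 i (mem_index_enum i); rewrite mulf_eq0 (gt_eqF (h0 i)) orbF.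
by rewrite sqn_eq0 => /eqP.
Qed.

Lemma psd_conj A V : psdmx A -> psdmx (V^t* *m A *m V).
Proof.
move=> [Ah Apos]; split=> [|v].
  by apply: adj_herm; rewrite !adj_mul trmxCK (herm_adj Ah) mulmxA.
by have := Apos (V *m v); rewrite adj_mul !mulmxA.
Qed.

Lemma posdef_conj A V : V \in unitmx -> posdefmx A ->
  posdefmx (V^t* *m A *m V).
Proof.
move=> Vunit Apos; have [_ Aform] := Apos.
have [Vh _] := psd_conj V (posdef_psd Apos).
split=> [|v v0]; first exact: Vh.
have /Aform : V *m v != 0.
  by apply: contra v0 => /eqP Vv; rewrite -(mulKmx Vunit v) Vv mulmx0.
by rewrite adj_mul !mulmxA.
Qed.

End Size.
End SpectralCalculus.

(** * Triangular products and reordered eigenbases *)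

Lemma mulmx_trig_diag (F : pzRingType) (n : nat) (L M : 'M[F]_n) i :
  is_trig_mx L -> is_trig_mx M -> (L *m M) i i = L i i * M i i.
Proof.
move=> /is_trig_mxP Lt /is_trig_mxP Mt; rewrite mxE (bigD1 i)//= big1 ?addr0//.
move=> j; rewrite neq_ltn => /orP[ji|ij]; first by rewrite Mt ?mulr0.
by rewrite Lt ?mul0r.
Qed.

Lemma mulmx_trig (F : pzRingType) (n : nat) (L M : 'M[F]_n) :
  is_trig_mx L -> is_trig_mx M -> is_trig_mx (L *m M).
Proof.
move=> /is_trig_mxP Lt /is_trig_mxP Mt; apply/is_trig_mxP => i j ij.
rewrite mxE big1// => k _; have [ki|ik] := leqP k i.
  by rewrite [M k j]Mt ?mulr0// (leq_ltn_trans ki).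
by rewrite Lt ?mul0r.
Qed.

Lemma udiag_row_perm (C : numClosedFieldType) (n : nat) (s : {perm 'I_n})
    (U : 'M[C]_n) (d : 'rV[C]_n) :
  udiag (row_perm s U) (\row_i d 0 (s i)) = udiag U d.
Proof.
apply/matrixP => i j; rewrite /udiag !mul_diag_mx 2!mxE.
rewrite [RHS](reindex_inj (@perm_inj _ s)).
by apply: eq_bigr => k _; rewrite !mxE.
Qed.

Lemma row_perm_unitary (C : numClosedFieldType) (n : nat) (s : {perm 'I_n})
    (U : 'M[C]_n) : U \is unitarymx -> row_perm s U \is unitarymx.
Proof.
move=> Uu; apply/row_unitarymxP => i j.
have rowE k : row k (row_perm s U) = row (s k) U.
  by apply/rowP => l; rewrite !mxE.
by rewrite !rowE (row_unitarymxP Uu) (inj_eq perm_inj).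
Qed.

(** * Weyl's and Hoelder's inequalities for Schatten quasi-norms *)

Section SchattenHoelder.
Variables (R : realType) (n : nat).
Implicit Types (A L U V W X Y : 'M[R[i]]_n) (g h t : 'I_n -> R).

Lemma powmx_half_sqr A : psdmx A -> powmx A 2^-1 *m powmx A 2^-1 = A.
Proof.
move=> Apsd; rewrite powmxE (specmxM _ _ (spectral_unitarymx A)).
rewrite [RHS](herm_specmx Apsd.1); congr specmx; apply/funext => i.
have half : 2^-1 + 2^-1 = 1 :> R by lra.
by rewrite -powRD half ?oner_eq0// powRr1// eigr_ge0.
Qed.

Lemma sqr_norm_diag_le L i : `|L i i| ^+ 2 <= (L *m L^t*) i i.
Proof.
rewrite mxE (bigD1 i)//= !mxE -normCK lerDl sumr_ge0// => j _.
by rewrite !mxE -normCK exprn_ge0.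
Qed.

(* Each factor [specmx U g] moves the current orthonormal basis by a QR step
   [V S = L V'], and [|L i i|^2] is at most the [i]-th diagonal entry of
   [(V S) (V S)^* = V S^2 V^*]. *)
Lemma qr_chain U W g (m : nat) : U \is unitarymx -> W \is unitarymx ->
  exists (L V : 'M[R[i]]_n) (Q : nat -> 'M[R[i]]_n),
    [/\ is_trig_mx L, V \is unitarymx,
        W *m specmx U (fun i => g i ^+ m) = L *m V,
        forall k, Q k \is unitarymx &
        forall i, sqn (L i i) <= \prod_(k < m) \sum_j sqn (Q k j i) * g j ^+ 2].
Proof.
move=> Uu Wu; elim: m => [|m [L [V [Q [Lt Vu WE Qu Lle]]]]].
  exists 1%:M, W, (fun=> W).
  split; [exact: scalar_mx_is_trig | exact: Wu | | by [] | move=> i].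
    by rewrite (specmx1 Uu) mulmx1 mul1mx.
  by rewrite big_ord0 mxE eqxx sqn1.
have [L' [V' [Lt' Vu' VE]]] := schmidt_trig (V *m specmx U g).
(* The new weights are the squared moduli of [U *m V^t*], which compares the basis [V] before the
   step with the eigenbasis [U]. *)
exists (L *m L'), V', (fun k => if (k < m)%N then Q k else U *m V^t*).
have Q'u : U *m V^t* \is unitarymx.
  by apply: (mul_unitarymx Uu); rewrite trmxC_unitary; exact: Vu.
split; [exact: (mulmx_trig Lt Lt') | exact: Vu' | | | move=> i].
- rewrite -mulmxA -VE mulmxA -WE -mulmxA (specmxM _ _ Uu).
  by congr (_ *m specmx U _); apply/funext => i; rewrite exprSr.
- by move=> k; case: ifP => _; [exact: Qu | exact: Q'u].
rewrite (mulmx_trig_diag i Lt Lt') sqnM big_ord_recr/= ltnn.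
rewrite ler_pM ?sqn_ge0//.
  rewrite (le_trans (Lle i))// le_eqVlt; apply/predU1P; left.
  by apply: eq_bigr => k _; rewrite ltn_ord.
rewrite -lecR sqnE (le_trans (sqr_norm_diag_le L' i))//.
have -> : L' *m L'^t* = udiag (U *m V^t*) (RCrow (fun j => g j ^+ 2)).
  rewrite (unitarymx_gram Vu' VE) adj_mul specmx_adj mulmxA -(mulmxA V).
  by rewrite (specmxM _ _ Uu) -udiag_conj; congr (_ *m udiag _ _ *m _).
rewrite udiag_diagE le_eqVlt; apply/predU1P; left; rewrite rmorph_sum.
apply: eq_bigr => j _; rewrite -sqnE [RHS]rmorphM.
by rewrite [RCrow _ 0 j]mxE.
Qed.

(* Weyl's majorant inequality; [m] is chosen so large that Jensen applies to
   [x |-> x `^ (m * r)], where the chain has [m] factors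
   [specmx U h ^ (1/2m)]. *)
Lemma weyl_powR U W h r : U \is unitarymx -> W \is unitarymx ->
  (forall i, 0 <= h i) -> 0 < r ->
  exists L V : 'M[R[i]]_n,
    [/\ is_trig_mx L, V \is unitarymx,
        W *m specmx U (fun i => h i `^ 2^-1) = L *m V &
        \sum_i sqn (L i i) `^ r <= \sum_i h i `^ r].
Proof.
move=> Uu Wu h0 r0; pose m := (Num.truncn r^-1).+1.
have m0 : 0 < m%:R :> R by rewrite ltr0n.
have mr : 1 <= m%:R * r.
  by rewrite -ler_pdivrMr// div1r ltW// truncnS_gt.
(* [g ^ m] is the square root of [h], while [g ^ 2 = h ^ (1/m)], raised to the power [m r], gives
   [h ^ r]. *)
pose g i := h i `^ (2 * m%:R)^-1.
have gX2 i : g i ^+ 2 = h i `^ m%:R^-1.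
  by rewrite -powR_mulrn ?powR_ge0// -powRrM invfM mulrAC mulVf ?mul1r//
    pnatr_eq0.
have gXm i : g i ^+ m = h i `^ 2^-1.
  by rewrite -powR_mulrn ?powR_ge0// -powRrM invfM mulfVK// gt_eqF.
have [L [V [Q [Lt Vu WE Qu Lle]]]] := qr_chain g m Uu Wu.
exists L, V; split; [exact: Lt | exact: Vu | |].
  by rewrite -WE; congr (_ *m specmx U _); apply/funext => i; rewrite gXm.
pose e k i := \sum_j sqn (Q k j i) * g j ^+ 2.
have e0 k i : 0 <= e k i.
  by apply: sumr_ge0 => j _; rewrite mulr_ge0 ?sqn_ge0 ?sqr_ge0.
(* AM-GM replaces the product along the chain by a mean over its [m] factors. *)
apply: (@le_trans _ _ (\sum_i (\sum_(k < m) e k i `^ (m%:R * r)) / m%:R)).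
  apply: ler_sum => i _; apply: (le_trans _ (agm_powR r (ltn0Sn _) (e0 ^~ i))).
  by apply: ge0_ler_powR; rewrite ?(ltW r0) ?nnegrE ?sqn_ge0// prodr_ge0.
rewrite -mulr_suml exchange_big/= ler_pdivrMr//.
apply: (@le_trans _ _ (\sum_(k < m) \sum_i h i `^ r)); last first.
  by rewrite sumr_const card_ord mulr_natr.
apply: ler_sum => k _.
(* Squared moduli of a unitary matrix are doubly stochastic: the column sums permit Jensen, the row
   sums collapse the double sum. *)
apply: (@le_trans _ _ (\sum_i \sum_j sqn (Q k j i) * h j `^ r)).
  apply: ler_sum => i _; apply: le_trans.
    exact: (jensen_powR (fun j => sqn_ge0 _) (unitarymx_sqn_col i (Qu k))
      (fun j => sqr_ge0 _) mr).
  apply: ler_sum => j _; rewrite gX2 -powRrM mulrA mulVf ?gt_eqF// mul1r.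
  exact: lexx.
rewrite exchange_big/=; apply: ler_sum => j _.
by rewrite -mulr_suml (unitarymx_sqn_row j (Qu k)) mul1r.
Qed.

(* If a zero of [t] could precede a nonzero entry, the diagonal of [L] would not
   be determined: [[0, 0], [1, 0]] and diag(0, 1) have the same Gram matrix. *)
Lemma trig_gram_diag L t : is_trig_mx L -> L *m L^t* = diag_mx (RCrow t) ->
  (forall i j : 'I_n, (i <= j)%N -> t i = 0 -> t j = 0) ->
  forall i, t i != 0 -> sqn (L i i) = t i.
Proof.
move=> Lt LE tmono.
(* Strong induction on the column, bounded by [m]. The vanishing off the diagonal is carried along
   because it leaves a single term in entry [(k, i)] of the Gram matrix. *)
suff H (m : nat) (i : 'I_n) : (i < m)%N -> t i != 0 ->
    sqn (L i i) = t i /\ forall k, k != i -> L k i = 0.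
  by move=> i /(H _ _ (ltnSn i))[].
elim: m i => [//|m IHm] i im ti0.
have col_i k : (diag_mx (RCrow t)) k i = L k i * Num.conj (L i i).
  rewrite -LE mxE (bigD1 i)//= !mxE big1 ?addr0// => j ji.
  rewrite !mxE; suff -> : L i j = 0 by rewrite conjC0 mulr0.
  move: ji; rewrite neq_ltn => /orP[ji|ij]; last by move/is_trig_mxP: Lt; apply.
  apply: (IHm j _ _).2; rewrite ?(leq_trans ji)//.
    (* A zero [t j] before [i] would force [t i = 0], so the induction hypothesis covers every
       earlier column. *)
    by apply: contra ti0 => /eqP/(tmono _ _ (ltnW ji)) ->.
  by rewrite neq_ltn ji orbT.
have Lii : sqn (L i i) = t i.
  by apply: complexI; rewrite sqnE normCK -col_i !mxE eqxx.
split=> // k ki; have /eqP := col_i k; rewrite !mxE (negbTE ki) mulr0n eq_sym.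
rewrite mulf_eq0 conjC_eq0 => /orP[/eqP//|/eqP Lii0].
by move: ti0; rewrite -Lii sqn_eq0 Lii0 eqxx.
Qed.

(** Sorting the eigenvalues in decreasing order puts the zeros last, as [trig_gram_diag]
    requires. *)
Lemma psd_sorted A : psdmx A -> exists W t,
  [/\ W \is unitarymx, A = specmx W t, forall i, 0 <= t i &
      forall i j : 'I_n, (i <= j)%N -> t i = 0 -> t j = 0].
Proof.
move=> Apsd; pose e := [tuple eigr A i | i < n].
have /tuple_permP[p sE] : perm_eq (sort >=%R e) e by rewrite perm_sort.
pose t i := eigr A (p i).
have tE (i : 'I_n) : t i = nth 0 (sort >=%R e) i.
  by rewrite sE nth_mktuple tnth_mktuple.
have sorted_e : sorted >=%R (sort >=%R e).
  by apply: sort_sorted => x y; exact: le_total.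
have t0 i : 0 <= t i by exact: eigr_ge0.
exists (row_perm p (spectralmx A)), t; split; [| |exact: t0|].
- exact/row_perm_unitary/spectral_unitarymx.
- rewrite [LHS](herm_specmx Apsd.1) /specmx -(udiag_row_perm p).
  by congr udiag; apply/rowP => i; rewrite !mxE.
move=> i j ij ti0; apply/eqP; rewrite eq_le t0 andbT -ti0 !tE.
have ge_tr : transitive (>=%R : rel R).
  by move=> x y z xy yz; exact: le_trans yz xy.
apply: (sorted_leq_nth ge_tr _ 0 sorted_e _ _ _ _ ij).
- by move=> x /=; exact: lexx.
- by rewrite inE size_sort size_tuple.
- by rewrite inE size_sort size_tuple.
Qed.

(** The factorization for [X] starts at the unitary [V1] left by the one for [Y], so the two chain
    into a single triangular factor [L1 *m L2], whose Gram matrix is diagonal in the basis [W]. *)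
Lemma trpow_hoelder X Y s a b : psdmx X -> psdmx Y ->
  0 < s -> 0 < a -> 0 < b -> a + b = 1 ->
  trpow (powmx Y 2^-1 *m X *m powmx Y 2^-1) s <=
    trpow X (s / a) `^ a * trpow Y (s / b) `^ b.
Proof.
move=> Xpsd Ypsd s0 a0 b0 ab.
have X0 := eigr_ge0 Xpsd; have Y0 := eigr_ge0 Ypsd.
have Uu := spectral_unitarymx.
pose KX := powmx X 2^-1; pose KY := powmx Y 2^-1.
have KXX : KX *m KX = X by exact: powmx_half_sqr.
have KYadj : KY^t* = KY by rewrite /KY powmxE specmx_adj.
have KXadj : KX^t* = KX by rewrite /KX powmxE specmx_adj.
have Mpsd : psdmx (KY *m X *m KY) by rewrite -{1}KYadj; exact: psd_conj.
have [W [t [Wu ME t0 tmono]]] := psd_sorted Mpsd.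
rewrite -/KY [X in trpow X]ME (trpow_specmx _ _ Wu).
have sb0 : 0 < s / b by rewrite divr_gt0.
have sa0 : 0 < s / a by rewrite divr_gt0.
have [L1 [V1 [Lt1 Vu1 WE1 Lle1]]] := weyl_powR (Uu _ _ Y) Wu Y0 sb0.
have [L2 [V2 [Lt2 Vu2 WE2 Lle2]]] := weyl_powR (Uu _ _ X) Vu1 X0 sa0.
rewrite -powmxE -/KY in WE1; rewrite -powmxE -/KX in WE2.
clearbody KX KY.
have LE : W *m KY *m KX = L1 *m L2 *m V2 by rewrite WE1 -!mulmxA -WE2.
have LLE : (L1 *m L2) *m (L1 *m L2)^t* = diag_mx (RCrow t).
  rewrite (unitarymx_gram Vu2 LE) !adj_mul KXadj KYadj !mulmxA.
  rewrite -(mulmxA _ KX KX) KXX -(mulmxA W KY) -(mulmxA W) ME /specmx /udiag.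
  by rewrite (unitarymx_mulKV _ Wu) -mulmxA (unitarymxP Wu) mulmx1.
(* Equality holds where [t i] is nonzero; elsewhere the bound is trivial. *)
have tle i : t i <= sqn (L1 i i) * sqn (L2 i i).
  have [->|ti0] := eqVneq (t i) 0; first by rewrite mulr_ge0 ?sqn_ge0.
  have <- := trig_gram_diag (mulmx_trig Lt1 Lt2) LLE tmono ti0.
  by rewrite (mulmx_trig_diag i Lt1 Lt2) sqnM.
pose u i := sqn (L2 i i) `^ (s / a); pose v i := sqn (L1 i i) `^ (s / b).
have u0 i : 0 <= u i by exact: powR_ge0.
have v0 i : 0 <= v i by exact: powR_ge0.
apply: (@le_trans _ _ (\sum_i u i `^ a * v i `^ b)).
  apply: ler_sum => i _; rewrite -!powRrM !divfK ?gt_eqF//.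
  rewrite -powRM ?sqn_ge0// ge0_ler_powR ?nnegrE ?(ltW s0) ?mulr_ge0 ?sqn_ge0//.
  by rewrite mulrC.
apply: (le_trans (hoelder_sum u0 v0 a0 b0 ab)).
rewrite !trpow_eigr; apply: ler_pM; [exact: powR_ge0 | exact: powR_ge0 | |].
  by rewrite ge0_ler_powR ?nnegrE ?(ltW a0) ?sumr_ge0// => i _; exact: powR_ge0.
by rewrite ge0_ler_powR ?nnegrE ?(ltW b0) ?sumr_ge0// => i _; exact: powR_ge0.
Qed.

End SchattenHoelder.

(** * Characteristic polynomials of congruences *)

Section CharPolyIdentities.
Variables (F : fieldType) (n : nat).
Implicit Types (P Q X C E S : 'M[F]_n).

Lemma sandwich_mulmxA P Q X S :
  P *m (Q *m X *m S) *m P = P *m Q *m X *m S *m P.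
Proof. by rewrite !mulmxA. Qed.

Lemma char_poly_mul3C P X : P \in unitmx ->
  char_poly (P *m X *m P) = char_poly (X *m (P *m P)).
Proof. by move=> Punit; rewrite -mulmxA char_poly_mulC// -mulmxA. Qed.

(** The product telescopes to [P *m X *m Q], a conjugate of [X]. *)
Lemma char_poly_congr_half P Q X : P *m Q = 1%:M ->
  char_poly (P *m X *m P *m (Q *m Q)) = char_poly X.
Proof.
move=> PQ; have [Punit _] := mulmx1_unit PQ.
rewrite mulmxA -(mulmxA _ P) PQ mulmx1 -mulmxA char_poly_mulC// -mulmxA.
by rewrite (mulmx1C PQ) mulmx1.
Qed.

(** Both sides are similar to [C *m (E *m E)]: on the right, [Q *m P] cancels in the middle. With
    [P] and [Q] the powers [1/2] and [-1/2] of [Z], the spectrum does not depend on [Z]. *)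
Lemma char_poly_split P Q E C : P *m Q = 1%:M -> E \in unitmx ->
  char_poly (E *m C *m E) =
  char_poly (Q *m C *m Q *m (P *m (E *m E) *m P)).
Proof.
move=> PQ Eunit; have [_ Qunit] := mulmx1_unit PQ.
rewrite (char_poly_mul3C _ Eunit) !mulmxA -(mulmxA _ Q P) (mulmx1C PQ) mulmx1.
by rewrite -!mulmxA (char_poly_mulC _ Qunit) -!mulmxA PQ mulmx1.
Qed.

(** Serves to read off the first spectrum at the extremal [Z], with [P] its power [-1/2];
    [char_poly_half_inv] does the same for the second, with power [1/2]. *)
Lemma char_poly_half P E C S : P \in unitmx -> E \in unitmx ->
  P *m P = E *m S *m E ->
  char_poly (P *m C *m P) = char_poly (E *m C *m E *m S).
Proof.
move=> Punit Eunit PP; rewrite (char_poly_mul3C _ Punit) PP.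
transitivity (char_poly (E *m (C *m E *m S))); last by rewrite !mulmxA.
by rewrite [RHS]char_poly_mulC// !mulmxA.
Qed.

Lemma char_poly_half_inv P E S : P \in unitmx -> E \in unitmx ->
  P *m P = invmx E *m S *m invmx E ->
  char_poly (P *m (E *m E) *m P) = char_poly S.
Proof.
move=> Punit Eunit PP; rewrite (char_poly_mul3C _ Punit) PP -mulmxA.
by rewrite char_poly_mulC// !mulmxA mulmxV// mul1mx mulmxKV.
Qed.

Lemma invmx_congr E S : E \in unitmx -> S \in unitmx ->
  invmx (invmx E *m S *m invmx E) = E *m invmx S *m E.
Proof.
move=> Eunit Sunit; set Z := _ *m S *m _.
have Z1 : Z *m (E *m invmx S *m E) = 1%:M.
  by rewrite /Z !mulmxA mulmxKV// mulmxK// mulVmx.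
by rewrite -[LHS]mulmx1 -Z1 mulKmx// (proj1 (mulmx1_unit Z1)).
Qed.

End CharPolyIdentities.

(** * Traces of powers and the variational formula *)

Section VariationalFormula.
Variables (R : realType) (n : nat).
Implicit Types (A C D E H T X Y Z : 'M[R[i]]_n) (h t : 'I_n -> R) (a b r s : R).

Lemma trpow_ge0 A r : 0 <= trpow A r.
Proof. by rewrite trpow_eigr; apply: sumr_ge0 => i _; exact: powR_ge0. Qed.

Lemma trpow0 r : r != 0 -> trpow (0 : 'M[R[i]]_n) r = 0.
Proof.
move=> r0; have U1 : (1%:M : 'M[R[i]]_n) \is unitarymx.
  by apply/unitarymxP; rewrite trmx1 map_mx1 mulmx1.
have -> : 0 = specmx 1%:M (fun=> 0) :> 'M[R[i]]_n.
  rewrite /specmx /udiag (_ : RCrow _ = 0) ?raddf0 ?mul0mx ?mulmx0//.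
  by apply/rowP => i; rewrite !mxE.
rewrite (trpow_specmx _ _ U1) big1// => i _; exact: powR0.
Qed.

Lemma posdefmx1 : posdefmx (1%:M : 'M[R[i]]_n).
Proof.
have U1 : (1%:M : 'M[R[i]]_n) \is unitarymx.
  by apply/unitarymxP; rewrite trmx1 map_mx1 mulmx1.
rewrite -(specmx1 U1); exact: (specmx_posdef U1 (fun=> ltr01)).
Qed.

Lemma powmx_adj A r : (powmx A r)^t* = powmx A r.
Proof. by rewrite powmxE; exact: specmx_adj. Qed.

Lemma powmx_posdef A r : posdefmx A -> posdefmx (powmx A r).
Proof.
move=> Apos; rewrite powmxE; apply: (specmx_posdef (spectral_unitarymx A)) => i.
exact/powR_gt0/eigr_gt0.
Qed.

Lemma powmxD A r s : posdefmx A -> powmx A r *m powmx A s = powmx A (r + s).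
Proof.
move=> Apos; rewrite !powmxE (specmxM _ _ (spectral_unitarymx A)); congr specmx.
by apply/funext => i; rewrite powRD// (gt_eqF (eigr_gt0 Apos i)) implybT.
Qed.

Lemma powmx0 A : powmx A 0 = 1%:M.
Proof.
rewrite powmxE -(specmx1 (spectral_unitarymx A)); congr specmx.
by apply/funext => i; rewrite powRr0.
Qed.

Lemma powmx1 A : posdefmx A -> powmx A 1 = A.
Proof.
move=> Apos; rewrite powmxE [RHS](herm_specmx Apos.1); congr specmx.
by apply/funext => i; rewrite powRr1// ltW// eigr_gt0.
Qed.

Lemma powmx_mulV A r : posdefmx A -> powmx A r *m powmx A (- r) = 1%:M.
Proof. by move=> Apos; rewrite (powmxD _ _ Apos) subrr powmx0. Qed.

Lemma powmx_unit A r : posdefmx A -> powmx A r \in unitmx.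
Proof. by move=> /(powmx_mulV r)/mulmx1_unit/proj1. Qed.

Lemma powmx_Nhalf_sqr A : posdefmx A ->
  powmx A (- 2^-1) *m powmx A (- 2^-1) = powmx A (-1).
Proof. by move=> Apos; rewrite (powmxD _ _ Apos); congr powmx; lra. Qed.

Lemma powmxN1 A : posdefmx A -> powmx A (-1) = invmx A.
Proof.
move=> Apos; have := powmx_mulV 1 Apos; rewrite (powmx1 Apos) => AV1.
by rewrite -[LHS](mulKmx (proj1 (mulmx1_unit AV1))) AV1 mulmx1.
Qed.

Lemma trpow_powmxV A r : posdefmx A -> trpow (powmx A (-1)) r = trpow A (- r).
Proof.
move=> Apos; rewrite powmxE (trpow_specmx _ _ (spectral_unitarymx A)).
rewrite trpow_eigr.
by apply: eq_bigr => i _; rewrite -powRrM mulN1r.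
Qed.

Lemma char_poly_powmx_half X Y : posdefmx Y ->
  char_poly (powmx Y 2^-1 *m X *m powmx Y 2^-1) = char_poly (X *m Y).
Proof.
move=> Ypos; rewrite (char_poly_mul3C X (powmx_unit 2^-1 Ypos)).
by rewrite (powmx_half_sqr (posdef_psd Ypos)).
Qed.

Lemma powmx_half_psd X Y : psdmx X ->
  psdmx (powmx Y 2^-1 *m X *m powmx Y 2^-1).
Proof. by move=> /(psd_conj (powmx Y 2^-1)); rewrite powmx_adj. Qed.

(** The trace depends only on the spectrum, so [H] may be replaced by the symmetrization of
    [X *m Y]. *)
Lemma trpow_le_hoelder H X Y s a b : H \is hermsymmx -> psdmx X -> posdefmx Y ->
  char_poly H = char_poly (X *m Y) -> 0 < s -> 0 < a -> 0 < b -> a + b = 1 ->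
  trpow H s <= trpow X (s / a) `^ a * trpow Y (s / b) `^ b.
Proof.
move=> Hh Xpsd Ypos HXY s0 a0 b0 ab.
apply: le_trans (trpow_hoelder Xpsd (posdef_psd Ypos) s0 a0 b0 ab).
rewrite (eq_trpow s Hh (powmx_half_psd Y Xpsd).1); first exact: lexx.
by rewrite (char_poly_powmx_half _ Ypos); exact: HXY.
Qed.

(* Since [char_poly X = char_poly (H' *m Y^-1)] for the symmetrization [H'] of
   [X *m Y], this is Hoelder's inequality for [X] with exponents [1/a, -b/a]. *)
Lemma trpow_ge_hoelder H X Y s a b : H \is hermsymmx -> psdmx X -> posdefmx Y ->
  char_poly H = char_poly (X *m Y) -> 0 < s -> 0 < a -> b < 0 -> a + b = 1 ->
  trpow X (s / a) `^ a * trpow Y (s / b) `^ b <= trpow H s.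
Proof.
move=> Hh Xpsd Ypos HXY s0 a0 b0 ab.
have H'psd := powmx_half_psd Y Xpsd.
rewrite (eq_trpow s Hh H'psd.1); last first.
  by rewrite (char_poly_powmx_half _ Ypos); exact: HXY.
set H' := _ *m X *m _ in H'psd *.
have XH' : char_poly X = char_poly (H' *m powmx Y (-1)).
  rewrite -(powmx_Nhalf_sqr Ypos).
  exact/esym/(char_poly_congr_half X (powmx_mulV 2^-1 Ypos)).
have aN0 : a != 0 by exact: lt0r_neq0.
have bN0 : b != 0 by exact: ltr0_neq0.
have a1 : 0 < a^-1 by rewrite invr_gt0.
have b1 : 0 < - b / a by apply: divr_gt0 a0; rewrite oppr_gt0; exact: b0.
have ab1 : a^-1 + - b / a = 1.
  have -> : b = 1 - a by lra.
  by field; exact: aN0.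
have := trpow_le_hoelder Xpsd.1 H'psd (powmx_posdef (-1) Ypos) XH'
  (divr_gt0 s0 a0) a1 b1 ab1.
have -> : s / a / a^-1 = s by field; exact: aN0.
rewrite (trpow_powmxV _ Ypos).
have -> : - (s / a / (- b / a)) = s / b by field; rewrite aN0 bN0.
exact: (powR_solve_le (trpow_ge0 _ _) (trpow_ge0 _ _) (trpow_ge0 _ _) a0 b0).
Qed.

(* A vanishing trace of powers of a positive definite matrix forces [n = 0]. *)
Lemma trpow_posdef_eq0 Y r : posdefmx Y -> trpow Y r = 0 ->
  forall A q, trpow A q = 0.
Proof.
move=> Ypos /eqP; rewrite trpow_eigr psumr_eq0; last first.
  by move=> i _; exact: powR_ge0.
move=> /allP Y0 A q.
rewrite trpow_eigr big1// => i _; have := Y0 i (mem_index_enum i).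
by rewrite powR_eq0 gt_eqF ?eigr_gt0.
Qed.

Section Extremum.
Variables (C E : 'M[R[i]]_n).
Hypotheses (Cpsd : psdmx C) (Eherm : E^t* = E) (Eunit : E \in unitmx).
Let T := E *m C *m E.
Let X Z := powmx Z (- 2^-1) *m C *m powmx Z (- 2^-1).
Let Y Z := powmx Z 2^-1 *m (E *m E) *m powmx Z 2^-1.

Lemma congr_psd : psdmx T.
Proof. by have := psd_conj E Cpsd; rewrite Eherm. Qed.

Lemma left_factor_psd Z : psdmx (X Z).
Proof. by have := psd_conj (powmx Z (- 2^-1)) Cpsd; rewrite powmx_adj. Qed.

Lemma right_factor_posdef Z : posdefmx Z -> posdefmx (Y Z).
Proof.
move=> Zpos; have EZunit : E *m powmx Z 2^-1 \in unitmx.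
  by rewrite unitmx_mul Eunit (powmx_unit _ Zpos).
have := posdef_conj EZunit posdefmx1.
by rewrite adj_mul Eherm powmx_adj mulmx1 /Y !mulmxA.
Qed.

Lemma char_poly_congr_factors Z : posdefmx Z ->
  char_poly T = char_poly (X Z *m Y Z).
Proof.
move=> Zpos; exact: (char_poly_split C (powmx_mulV 2^-1 Zpos) Eunit).
Qed.

(* The eigenvalues of the symmetrization of [Z] are chosen so that both traces
   become [\sum_i t i `^ s], except that each [i] with [t i = 0] adds [d] to
   the second one. *)
Lemma extremal_factorization s a b d :
  0 < s -> 0 < a -> b != 0 -> a + b = 1 -> 0 < d ->
  exists Z, [/\ posdefmx Z, trpow (X Z) (s / a) = trpow T s,
    trpow (Y Z) (s / b) <= trpow T s + n%:R * d &
    T \in unitmx -> trpow (Y Z) (s / b) = trpow T s].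
Proof.
move=> s0 a0 b0 ab d0.
have Wu := spectral_unitarymx T; have t0 := eigr_ge0 congr_psd.
have TE := herm_specmx congr_psd.1; have trT := trpow_eigr T s.
move: (spectralmx T) (eigr T) Wu t0 TE trT => W t Wu t0 TE trT.
pose w i := if t i == 0 then d else t i `^ s.
have w0 i : 0 < w i.
  by rewrite /w; case: eqVneq => // ti0; rewrite powR_gt0// lt_def ti0 t0.
(* This exponent gives [z i ^ (s / b) = w i]. *)
pose z i := w i `^ (b / s).
have z0 i : 0 < z i by exact: powR_gt0.
have zN0 i : z i != 0 by rewrite gt_eqF.
have sN0 : s != 0 by rewrite gt_eqF.
have aN0 : a != 0 by rewrite gt_eqF.
(* With this [Z], [Y Z] has the spectrum of [S] and [X Z] that of [T *m invmx S], where [S] and [T]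
   are diagonal in the same basis [W]. *)
pose S := specmx W z; pose Z := invmx E *m S *m invmx E.
have Sunit : S \in unitmx by exact: specmx_unit Wu zN0.
have EVunit : invmx E \in unitmx by rewrite unitmx_inv.
have EVadj : (invmx E)^t* = invmx E.
  by rewrite trmx_inv map_invmx Eherm.
have Zpos : posdefmx Z.
  rewrite /Z -{1}EVadj; apply: posdef_conj; first by rewrite unitmx_inv.
  exact: specmx_posdef.
have ZmE : powmx Z (- 2^-1) *m powmx Z (- 2^-1) = E *m invmx S *m E.
  rewrite (powmx_Nhalf_sqr Zpos) (powmxN1 Zpos).
  exact: (invmx_congr Eunit Sunit).
have YE : trpow (Y Z) (s / b) = \sum_i w i.
  rewrite (@trpow_char_poly _ _ (Y Z) z _ (right_factor_posdef Zpos).1).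
    apply: eq_bigr => i _; rewrite /z -powRrM.
    have -> : b / s * (s / b) = 1 by field; rewrite b0 sN0.
    by rewrite powRr1// ltW.
  rewrite -(char_poly_specmx _ Wu) -/S.
  apply: (char_poly_half_inv (powmx_unit _ Zpos) Eunit).
  exact: (powmx_half_sqr (posdef_psd Zpos)).
exists Z; split; first exact: Zpos.
- rewrite (@trpow_char_poly _ _ (X Z) (fun i => t i * (z i)^-1) _
    (left_factor_psd Z).1).
    rewrite trT; apply: eq_bigr => i _; rewrite /z /w.
    case: eqVneq => [->|ti0].
      by rewrite mul0r !powR0// mulf_neq0// invr_eq0.
    by apply: powR_balance => //; rewrite lt_def ti0 t0.
  rewrite -(char_poly_specmx _ Wu) -(specmxM _ _ Wu) -TE -(specmxV Wu zN0) -/S.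
  exact: (char_poly_half C (powmx_unit _ Zpos) Eunit ZmE).
- rewrite YE trT (_ : n%:R * d = \sum_(i < n) d).
    rewrite -big_split; apply: ler_sum => i _; rewrite /w.
    case: eqVneq => _; first by rewrite lerDr powR_ge0.
    by rewrite lerDl ltW.
  by rewrite sumr_const card_ord mulr_natl.
- rewrite YE trT => Tunit; apply: eq_bigr => i _; rewrite /w ifN//.
  by apply: (unitmx_specmx i Wu); rewrite -TE.
Qed.

Section Values.
Variables (s a b : R).
Hypotheses (s0 : 0 < s) (a0 : 0 < a) (ab : a + b = 1).
Let F Z := trpow (X Z) (s / a).
Let G Z := trpow (Y Z) (s / b).
Let P := trpow T s.

Definition factor_prods : set R :=
  [set F Z `^ a * G Z `^ b | Z in @posdefmx R n].
Definition factor_sums : set R :=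
  [set a * F Z + b * G Z | Z in @posdefmx R n].

Lemma weighted_sum_id : a * P + b * P = P.
Proof. by rewrite -mulrDl ab mul1r. Qed.

Lemma weighted_prod_id : P `^ a * P `^ b = P.
Proof.
by rewrite -powRD ab ?oner_eq0// powRr1// trpow_ge0.
Qed.

(** The first trace and [P] both vanish, so the identity serves as a witness. *)
Lemma factor_prods_zero : C = 0 -> b != 0 -> factor_prods P.
Proof.
move=> C0 b0; exists 1%:M; first exact: posdefmx1.
rewrite /P /F /T /X C0 !(mulmx0, mul0mx) !trpow0 ?powR0 ?mul0r//.
- by rewrite gt_eqF.
- by rewrite gt_eqF.
- by rewrite gt_eqF// divr_gt0.
Qed.

(** Hoelder bounds the products from below and Young passes this to the sums; near-extremal [Z] show
    that the bound is sharp. *)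
Lemma infimum_values : 0 < b ->
  [/\ infimums factor_prods P, infimums factor_sums P,
      T \in unitmx \/ C = 0 -> is_min factor_prods P &
      T \in unitmx -> is_min factor_sums P].
Proof.
move=> b0; have bN0 : b != 0 := lt0r_neq0 b0.
have lbP Z : posdefmx Z -> P <= F Z `^ a * G Z `^ b.
  move=> Zpos; exact: (trpow_le_hoelder congr_psd.1 (left_factor_psd Z)
    (right_factor_posdef Zpos) (char_poly_congr_factors Zpos) s0 a0 b0 ab).
have prod_sum Z : F Z `^ a * G Z `^ b <= a * F Z + b * G Z.
  exact: (young_powR (trpow_ge0 _ _) (trpow_ge0 _ _) a0 b0 ab).
have lprods : lbound factor_prods P by move=> _ [Z Zpos <-]; exact: lbP.
have lsums : lbound factor_sums P.
  by move=> _ [Z Zpos <-]; exact: le_trans (lbP Z Zpos) (prod_sum Z).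
(* One approximation treats both sets: by Young, each sum also dominates a product. *)
have inf_of (vals : set R) : (forall Z, posdefmx Z ->
      exists2 v, vals v & v <= a * F Z + b * G Z) ->
    forall x, lbound vals x -> x <= P.
  (* The second trace exceeds [P] by at most [n * d] and enters with weight [b]. *)
  move=> valsP x lx; apply: (@ler_addM_gt0 _ _ _ (b * n%:R)) => d d0.
  have [Z [Zpos FE Gle _]] := extremal_factorization s0 a0 bN0 ab d0.
  have [v vv vle] := valsP Z Zpos; apply: le_trans (lx v vv) (le_trans vle _).
  rewrite /F FE -[X in _ <= X + _]weighted_sum_id -addrA lerD2l -mulrA -mulrDr.
  by rewrite (ler_wpM2l (ltW b0)).
(* For invertible [T] no eigenvalue is replaced, so any [d] works; [1] is taken. *)
have attained : T \in unitmx -> exists Z, [/\ posdefmx Z, F Z = P & G Z = P].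
  move=> Tunit.
  have [Z [Zpos FE _ GE]] := extremal_factorization s0 a0 bN0 ab ltr01.
  by exists Z; split; [exact: Zpos | exact: FE | exact: GE].
split.
- split; [exact: lprods | move=> x lx].
  apply: (inf_of factor_prods) lx => Z Zpos.
  by exists (F Z `^ a * G Z `^ b); [exists Z | exact: prod_sum].
- split; [exact: lsums | move=> x lx].
  apply: (inf_of factor_sums) lx => Z Zpos.
  by exists (a * F Z + b * G Z); [exists Z |].
- move=> TC; split; last exact: lprods.
  case: TC => [/attained[Z [Zpos FE GE]]|C0].
    by exists Z; [exact: Zpos | rewrite FE GE; exact: weighted_prod_id].
  exact: factor_prods_zero C0 bN0.
- move=> /attained[Z [Zpos FE GE]]; split; last exact: lsums.
  by exists Z; [exact: Zpos | rewrite FE GE; exact: weighted_sum_id].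
Qed.

Lemma supremum_values : b < 0 ->
  [/\ supremums factor_prods P, supremums factor_sums P,
      T \in unitmx \/ C = 0 -> is_max factor_prods P &
      T \in unitmx -> is_max factor_sums P].
Proof.
move=> b0; have bN0 : b != 0 := ltr0_neq0 b0.
have ubP Z : posdefmx Z -> F Z `^ a * G Z `^ b <= P.
  move=> Zpos; exact: (trpow_ge_hoelder congr_psd.1 (left_factor_psd Z)
    (right_factor_posdef Zpos) (char_poly_congr_factors Zpos) s0 a0 b0 ab).
(* The reversed Young inequality needs a positive [G Z]; if [G Z] vanishes, so does [F Z]. *)
have sum_prod Z : posdefmx Z -> a * F Z + b * G Z <= F Z `^ a * G Z `^ b.
  move=> Zpos; have [G0|GN0] := eqVneq (G Z) 0.
    rewrite [F Z](trpow_posdef_eq0 (right_factor_posdef Zpos) G0) G0 !mulr0.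
    rewrite addr0.
    by rewrite mulr_ge0 ?powR_ge0.
  apply: reverse_young_powR => //; first exact: trpow_ge0.
  by rewrite lt_def GN0 trpow_ge0.
have uprods : ubound factor_prods P by move=> _ [Z Zpos <-]; exact: ubP.
have usums : ubound factor_sums P.
  by move=> _ [Z Zpos <-]; exact: le_trans (sum_prod Z Zpos) (ubP Z Zpos).
have sup_of (vals : set R) : (forall Z, posdefmx Z ->
      exists2 v, vals v & a * F Z + b * G Z <= v) ->
    forall x, ubound vals x -> P <= x.
  (* Since [b < 0], the excess [n * d] of the second trace lowers the sum, by at most
     [- (b * n * d)]. *)
  move=> valsP x ux; apply: (@ler_addM_gt0 _ _ _ (- (b * n%:R))) => d d0.
  rewrite mulNr -lerBlDr opprK.
  have [Z [Zpos FE Gle _]] := extremal_factorization s0 a0 bN0 ab d0.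
  have [v vv vle] := valsP Z Zpos; apply: le_trans _ (le_trans vle (ux v vv)).
  rewrite /F FE -[X in X + _ <= _]weighted_sum_id -addrA lerD2l -mulrA -mulrDr.
  by rewrite (ler_wnM2l (ltW b0)).
have attained : T \in unitmx -> exists Z, [/\ posdefmx Z, F Z = P & G Z = P].
  move=> Tunit.
  have [Z [Zpos FE _ GE]] := extremal_factorization s0 a0 bN0 ab ltr01.
  by exists Z; split; [exact: Zpos | exact: FE | exact: GE].
split.
- split; [exact: uprods | move=> x ux].
  apply: (sup_of factor_prods) ux => Z Zpos.
  by exists (F Z `^ a * G Z `^ b); [exists Z | exact: sum_prod].
- split; [exact: usums | move=> x ux].
  apply: (sup_of factor_sums) ux => Z Zpos.
  by exists (a * F Z + b * G Z); [exists Z |].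
- move=> TC; split; last exact: uprods.
  case: TC => [/attained[Z [Zpos FE GE]]|C0].
    by exists Z; [exact: Zpos | rewrite FE GE; exact: weighted_prod_id].
  exact: factor_prods_zero C0 bN0.
- move=> /attained[Z [Zpos FE GE]]; split; last exact: usums.
  by exists Z; [exact: Zpos | rewrite FE GE; exact: weighted_sum_id].
Qed.

End Values.

End Extremum.

End VariationalFormula.

Theorem corollary3p3 (R : realType) (n : nat) (A B K : 'M[R[i]]_n) (p q s : R)
    (hA : posdefmx A) (hB : posdefmx B) :
  ((0 < s /\ 0 < p /\ 0 < q) \/ (0 < s /\ p < 0 /\ q < 0) ->
     [/\ infimums (prod_values K p q s A B) (Psi K p q s A B),
         infimums (sum_values K p q s A B) (Psi K p q s A B),
         K \in unitmx \/ K = 0 ->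
           is_min (prod_values K p q s A B) (Psi K p q s A B) &
         K \in unitmx ->
           is_min (sum_values K p q s A B) (Psi K p q s A B)])
  /\
  ((0 < s /\ 0 < p /\ q < 0 /\ 0 < p + q) \/
   (0 < s /\ p < 0 /\ 0 < q /\ p + q < 0) ->
     [/\ supremums (prod_values K p q s A B) (Psi K p q s A B),
         supremums (sum_values K p q s A B) (Psi K p q s A B),
         K \in unitmx \/ K = 0 ->
           is_max (prod_values K p q s A B) (Psi K p q s A B) &
         K \in unitmx ->
           is_max (sum_values K p q s A B) (Psi K p q s A B)]).
Proof.
pose C := K^t* *m powmx A p *m K; pose E := powmx B (q / 2).
have Cpsd : psdmx C by exact: psd_conj (posdef_psd (powmx_posdef p hA)).
have Eadj : E^t* = E by exact: powmx_adj.
have Eunit : E \in unitmx by exact: powmx_unit hB.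
have EE : E *m E = powmx B q.
  by rewrite (powmxD _ _ hB); congr powmx; lra.
(* Powers of [A] and [B] are invertible, so invertibility of [K] passes to [E *m C *m E]. *)
have Tunit : K \in unitmx -> E *m C *m E \in unitmx.
  move=> Kunit; rewrite unitmx_mul Eunit andbT unitmx_mul Eunit /C unitmx_mul.
  rewrite Kunit andbT unitmx_mul (powmx_unit _ hA) andbT map_unitmx unitmx_tr.
  exact: Kunit.
have TC : K \in unitmx \/ K = 0 -> E *m C *m E \in unitmx \/ C = 0.
  by case=> [/Tunit|K0]; [left | right; rewrite /C K0 mulmx0].
have sandwichA (M : 'M[R[i]]_n) :
    M *m C *m M = M *m K^t* *m powmx A p *m K *m M.
  exact: sandwich_mulmxA.
have PsiE : Psi K p q s A B = trpow (E *m C *m E) s by rewrite sandwichA.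
have exponentE x : s / (x / (p + q)) = s * (p + q) / x.
  by rewrite invf_div mulrA.
have trAE Z : trA K p q s A Z =
    trpow (powmx Z (- 2^-1) *m C *m powmx Z (- 2^-1)) (s / (p / (p + q))).
  rewrite (sandwichA (powmx Z (- 2^-1))) (exponentE p) /trA; exact: erefl.
have trBE Z : trB p q s B Z =
    trpow (powmx Z 2^-1 *m (E *m E) *m powmx Z 2^-1) (s / (q / (p + q))).
  rewrite [E *m E]EE (exponentE q) /trB; exact: erefl.
set a := p / (p + q) in trAE *; set b := q / (p + q) in trBE *.
have prodE : prod_values K p q s A B = factor_prods C E s a b.
  exact: (congr1 (image _) (funext (fun Z =>
    congr2 (fun x y => x `^ a * y `^ b) (trAE Z) (trBE Z)))).
have sumE : sum_values K p q s A B = factor_sums C E s a b.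
  exact: (congr1 (image _) (funext (fun Z =>
    congr2 (fun x y => a * x + b * y) (trAE Z) (trBE Z)))).
rewrite prodE sumE PsiE; split=> pqs.
  have [s0 /weights_same_sign[a0 b0 ab]] :
      0 < s /\ (0 < p /\ 0 < q \/ p < 0 /\ q < 0).
    by case: pqs => -[s0 pq]; split; [exact: s0 | left | exact: s0 | right].
  have [ip im mp ms] := infimum_values Cpsd Eadj Eunit s0 a0 ab b0.
  split; [exact: ip | exact: im | |].
    by move=> /TC; exact: mp.
  by move=> /Tunit; exact: ms.
have [s0 /weights_opposite_sign[a0 b0 ab]] :
    0 < s /\ (0 < p /\ q < 0 /\ 0 < p + q \/ p < 0 /\ 0 < q /\ p + q < 0).
  by case: pqs => -[s0 pq]; split; [exact: s0 | left | exact: s0 | right].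
have [sp ss mp ms] := supremum_values Cpsd Eadj Eunit s0 a0 ab b0.
split; [exact: sp | exact: ss | |].
  by move=> /TC; exact: mp.
by move=> /Tunit; exact: ms.
Qed.
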